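(* Consider a non-additive multislope ski rental instance with states $0,\dots,k$, buying costs $0\le b_0<b_1<\dots<b_k$ and rental rates $r_0>r_1>\dots>r_k\ge0$, in which entering state $j$ (from any state) costs $b_j$ and being in state $i$ costs rent at rate $r_i$; the player starts in state $0$ at time $0$ (paying $b_0$). Let $\textsc{opt}(t)=\min_i(b_i+r_it)$, let $s_1=\frac{b_1-b_0}{r_0-r_1}$, and for $B\ge0$ let $\textsc{opt}^{-1}(B)$ denote the time $t$ with $\textsc{opt}(t)=B$ (taken to be $\infty$ if $B$ exceeds $\sup_t\textsc{opt}(t)$). Consider the following randomized strategy with parameter $\alpha=e$: choose $X$ uniformly at random in $[0,1)$, set $B_1=\textsc{opt}(s_1)/\alpha^X$ and $B_{j+1}=\alpha B_j$, let $\tau_0=0$, $\tau_j=\textsc{opt}^{-1}(B_j)$, and let $i_j$ be a state attaining $\textsc{opt}(\tau_j)$, choosing the smaller index in case of a tie. In iteration $j$, i.e. during the time interval $[\tau_{j-1},\tau_j)$, the strategy buys state $i_j$ at the beginning of the iteration and stays in it until the iteration ends. Then for every termination time $\tau\ge0$, the expected cost of this strategy up to time $\tau$ is at most $e\cdot\textsc{opt}(\tau)$.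
   Context: In the non-additive multislope ski rental problem each slope is bought ''from scratch'': every switch into state $j$ costs the full buying cost $b_j$. The adversary chooses the termination time $\tau$ knowing the strategy but not the outcome of its random choices; the offline optimum for termination time $\tau$ is $\textsc{opt}(\tau)=\min_i(b_i+r_i\tau)$.
   Formalization: The formal theorem additionally assumes that every state attains opt(t) at some time t ≥ 0; without this the claim fails, e.g. b=(0,0.5,0.72), r=(1,0.9999,0.001), where the strategy buys state 2 at time 0. *)

(* Defs.v *)
From HB Require Import structures.
From mathcomp Require Import all_boot all_order all_algebra.
From mathcomp Require Import all_classical all_reals all_analysis.
Set Implicit Arguments. Unset Strict Implicit. Unset Printing Implicit Defensive.
Import Order.TTheory GRing.Theory Num.Theory.
Local Open Scope ring_scope.
Local Open Scope classical_set_scope.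

Section SkiRental.
Variables (R : realType) (k : nat) (b r : nat -> R).

Definition opt (t : R) : R :=
  \big[Order.min/(b 0%N + r 0%N * t)]_(i < k.+1) (b i + r i * t).

Definition s1 : R := (b 1%N - b 0%N) / (r 0%N - r 1%N).

(* opt^{-1}(B): the (first) time t >= 0 with opt(t) >= B, i.e. the time with
   opt(t) = B when B is in the range of opt; +oo if no such time exists
   (B exceeds sup opt); 0 if B <= opt(0). *)
Definition optinv (B : R) : \bar R :=
  ereal_inf (EFin @` [set t : R | 0 <= t /\ B <= opt t]).

Definition argopt (t : R) : nat :=
  find (fun i => b i + r i * t == opt t) (iota 0 k.+1).

Definition Bval (x : R) (j : nat) : R := opt s1 / expR x * expR (j.-1)%:R.

Definition tau (x : R) (j : nat) : \bar R :=
  if j is 0 then 0%E else optinv (Bval x j).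

(* i_0 = 0 (initial state); i_j = smallest state attaining opt(tau_j)
   (state k when tau_j = +oo, i.e. the state optimal for all large times) *)
Definition istate (x : R) (j : nat) : nat :=
  if j is 0 then 0%N else
  if tau x j is (t%:E)%E then argopt t else k.

(* cost incurred in iteration j >= 1 (interval [tau_{j-1}, tau_j)) up to
   termination time T: buying cost b_{i_j} at time tau_{j-1} if this is a
   genuine switch of state, plus rent r_{i_j} for the part of the interval
   that lies before T. Nothing if the iteration starts after T. *)
Definition iter_cost (x T : R) (j : nat) : \bar R :=
  if (tau x j.-1 <= T%:E)%E then
    ((if istate x j != istate x j.-1 then b (istate x j) else 0)
     + r (istate x j) * (fine (Order.min (tau x j) T%:E) - fine (tau x j.-1)))%:E
  else 0%E.

Definition strat_cost (x T : R) : \bar R :=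
  ((b 0%N)%:E + \sum_(j <oo) iter_cost x T j.+1)%E.

Definition expected_cost (T : R) : \bar R :=
  (\int[lebesgue_measure]_(x in `[0%R, 1%R[) strat_cost x T)%E.

End SkiRental.

(* Main.v *)
(* Write P = opt T and A = opt s1. As tau_1 <= s1, the first iteration is spent
   in state 0, so with the initial payment it costs at most min(P, A).
   Iteration l + 1 (l >= 1) starts only if B_l <= P, and it then costs at most
   opt (tau_{l+1}) <= B_{l+1} = e B_l. Since B_l = A e^(l-1-x) with x uniform,
   the intervals (A e^(l-2), A e^(l-1)] swept by the B_l tile (A / e, +oo), and
   d(B_l) = - B_l dx; hence the expectation of the sum of the B_l <= P is
   max(P - A / e, 0). The total min(P, A) + max(e P - A, 0) is at most e P. *)

Require Import Defs.
From HB Require Import structures.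
From mathcomp Require Import all_boot all_order all_algebra.
From mathcomp Require Import all_classical all_reals all_analysis.
From mathcomp Require Import ring lra measurable_realfun.
Import Order.TTheory GRing.Theory Num.Theory.
Import numFieldNormedType.Exports.
Local Open Scope ring_scope.

(** * Integrals and sums of truncated exponentials *)

(* Unlike [ge0_le_integral], the smaller function need not be measurable. *)
Lemma ge0_le_integral_nonmeasurable d (X : measurableType d) (R : realType)
    (mu : {measure set X -> \bar R}) (D : set X) (f g : X -> \bar R) :
  (forall x, D x -> (0 <= f x)%E) -> (forall x, D x -> (f x <= g x)%E) ->
  (\int[mu]_(x in D) f x <= \int[mu]_(x in D) g x)%E.
Proof.
move=> f0 fg; rewrite !ge0_integralE//; last first.
  by move=> x Dx; exact: le_trans (f0 _ Dx) (fg _ Dx).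
(* A simple function below [f] is also below [g], so the supremum for [g] runs over more
   functions. *)
apply: ge_ereal_sup => _ [h hf <-]; apply: ereal_sup_ubound; exists h => //.
move=> x /=; apply: le_trans (hf x) _; rewrite /patch.
by case: ifPn => // /set_mem /fg.
Qed.

Lemma integral_expRN (R : realType) (C c : R) : c < 1 ->
  (\int[lebesgue_measure]_(x in `[c, 1%R]%classic) (C * expR (- x))%:E =
   (C * expR (- c) - C / expR 1)%:E)%E.
Proof.
move=> c1.
have dF (x : R) : is_derive x 1 (fun y : R => - C * expR (- y)) (C * expR (- x)).
  have h := is_derive1_comp (is_derive_expR (- x))
    (is_deriveN (is_derive_id x 1)).
  apply: (is_derive_eq (is_deriveZ (- C) h)).
  by rewrite /GRing.scale /=; ring.
have cexp (a : R) : continuous (fun y : R => a * expR (- y)).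
  move=> x; apply: cvgM; first exact: cvg_cst.
  apply: (@continuous_comp _ _ _ (-%R : R -> R) expR).
    exact: opp_continuous.
  exact: continuous_expR.
rewrite (@continuous_FTC2 _ _ (fun y : R => - C * expR (- y)))//.
- by rewrite -EFinB expRN expRN; congr (_%:E); field; rewrite !gt_eqF ?expR_gt0.
- exact: continuous_subspaceT (cexp C).
- split.
  + by move=> x _; have [] := dF x.
  + exact/cvg_at_right_filter/cexp.
  + exact/cvg_at_left_filter/cexp.
- by move=> x _; rewrite derive1E; have [_ ->] := dF x.
Qed.

Lemma measurable_truncated_expRN (R : realType) (C P : R) (D : set R) :
  measurable_fun D
    (fun x : R => if C * expR (- x) <= P then C * expR (- x) else 0).
Proof.
have mf : measurable_fun [set: R] (fun x : R => C * expR (- x)).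
  apply: measurable_funM => //.
  exact: measurableT_comp (@measurable_expR R) (@oppr_measurable _ _).
apply: measurable_funTS.
by apply: measurable_fun_ifT => //; exact: measurable_fun_ler.
Qed.

(** As x runs over [0, 1), C e^(-x) decreases from C towards C / e, so the truncation leaves only
    the part of the interval beyond the point where the value drops to min(P, C). The outer maximum
    covers the case where P is never reached. *)
Lemma integral_truncated_expRN (R : realType) (C P : R) : 0 < C ->
  (\int[lebesgue_measure]_(x in `[0%R, 1%R[%classic)
     (if (C * expR (- x) <= P)%R then C * expR (- x) else 0)%:E <=
   (Num.max (Num.min P C - C / expR 1) 0)%:E)%E.
Proof.
move=> C0; have e0 : 0 < expR 1 :> R by exact: expR_gt0.
have [qle|qgt] := leP (Num.min P C) (C / expR 1).
  rewrite integral0_eq ?lee_fin ?le_max ?lexx ?orbT// => x /=.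
  rewrite in_itv /= => /andP[x0 x1]; case: ifPn => // CP; exfalso.
  (* Strict because 1 is excluded from the interval: every value exceeds C / e, so the integrand
     vanishes. *)
  have CN1 : C / expR 1 < C * expR (- x).
    by rewrite -expRN ltr_pM2l// ltr_expR ltrN2.
  have CC : C * expR (- x) <= C.
    by rewrite -[leRHS]mulr1 ler_pM2l// -expR0 ler_expR oppr_le0.
  have : C * expR (- x) <= Num.min P C by rewrite le_min CP.
  by move=> /le_trans/(_ qle); rewrite leNgt CN1.
set q := Num.min P C in qgt *; have q0 : 0 < q.
  by apply: lt_trans qgt; rewrite divr_gt0.
(* [c] is the solution of C e^(-c) = q; it lies in [0, 1) since C / e < q <= C. *)
pose c := - ln (q / C); have Ec : C * expR (- c) = q.
  by rewrite /c opprK lnK ?posrE ?divr_gt0// mulrC divfK ?gt_eqF.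
have c1 : c < 1.
  by rewrite -ltrN2 -ltr_expR -(ltr_pM2l C0) Ec expRN.
have c0 : 0 <= c.
  rewrite -oppr_le0 -ler_expR expR0 -(ler_pM2l C0) Ec mulr1 /q.
  by rewrite ge_min lexx orbT.
apply: (@le_trans _ _ (\int[lebesgue_measure]_(x in `[c, 1%R]%classic)
    (C * expR (- x))%:E)%E); last first.
  by rewrite integral_expRN// Ec lee_fin le_max lexx.
rewrite integral_mkcond [leRHS]integral_mkcond.
apply: ge0_le_integral_nonmeasurable => x _; rewrite /patch.
  by case: ifP => // _; case: ifP => // _; rewrite lee_fin mulr_ge0// ?ltW ?expR_gt0.
case: ifPn => [/set_mem /=|_]; last first.
  by case: ifP => // _; rewrite lee_fin mulr_ge0// ?ltW ?expR_gt0.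
rewrite in_itv /= => /andP[x0 x1]; case: ifPn => CP; last first.
  by case: ifP => // _; rewrite lee_fin mulr_ge0// ?ltW ?expR_gt0.
rewrite mem_set//= in_itv /= (ltW x1) andbT.
rewrite -lerN2 -ler_expR -(ler_pM2l C0) Ec /q le_min CP /=.
by rewrite -[leRHS]mulr1 ler_pM2l// -expR0 ler_expR oppr_le0.
Qed.

(** Each summand is the length of the part below P of (A e^(l-1), A e^l]; consecutive intervals
    share an endpoint, so the lengths telescope. *)
Lemma sum_truncated_geometric (R : realType) (A P : R) (n : nat) : 0 < A ->
  \sum_(l < n) Num.max
     (Num.min P (A * expR l%:R) - A * expR l%:R / expR 1) 0 <=
  Num.max (P - A / expR 1) 0.
Proof.
move=> A0; have e0 : 0 < expR 1 :> R by exact: expR_gt0.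
(* Strengthening for the induction: the first n intervals end at A e^(n-1), written A e^n / e so
   that n = 0 gives A / e. *)
suff : \sum_(l < n) Num.max
     (Num.min P (A * expR l%:R) - A * expR l%:R / expR 1) 0 <=
    Num.max (Num.min P (A * expR n%:R / expR 1) - A / expR 1) 0.
  by move=> /le_trans; apply; rewrite ge_max !le_max lexx orbT andbT
    lerB// ge_min lexx.
elim: n => [|n IH].
  by rewrite big_ord0 le_max lexx orbT.
rewrite big_ord_recr /=; apply: le_trans (lerD IH (lexx _)) _.
have -> : A * expR n.+1%:R / expR 1 = A * expR n%:R.
  by rewrite -[n.+1]addn1 natrD expRD; field; rewrite gt_eqF.
set v := A * expR n%:R; have v0 : 0 <= v by rewrite mulr_ge0 ?expR_ge0 ?ltW.
have Av : A / expR 1 <= v / expR 1.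
  by rewrite ler_pM2r ?invr_gt0// ler_peMr ?(ltW A0)// -[leLHS]expR0 ler_expR.
have vv : v / expR 1 <= v.
  by rewrite ler_pdivrMr// ler_peMr// -[leLHS]expR0 ler_expR.
move: Av vv; move: (A / expR 1) (v / expR 1) => a u au uv.
rewrite !maxEle !minEle; case: (leP P u) => ?; case: (leP P v) => ?;
  by do ![case: ifPn; rewrite -?ltNge => ?]; lra.
Qed.

(** * The lower envelope [opt] and its generalized inverse *)

Section LowerEnvelope.
Set Implicit Arguments.
Unset Strict Implicit.
Variables (R : realType) (k : nat) (b r : nat -> R).
Hypothesis k_gt0 : (0 < k)%N.
Hypothesis b0_ge0 : 0 <= b 0%N.
Hypothesis b_incr : forall i, (i < k)%N -> b i < b i.+1.
Hypothesis r_decr : forall i, (i < k)%N -> r i.+1 < r i.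
Hypothesis rk_ge0 : 0 <= r k.
(** Every line touches the envelope. For state 1 this makes [s1] the first breakpoint; for state [k]
    it makes that state optimal at all large times. *)
Hypothesis useful : forall i, (i <= k)%N ->
  exists t : R, 0 <= t /\ opt k b r t = b i + r i * t.

Implicit Types x t s T B : R.

Local Notation opt := (opt k b r).
Local Notation s1 := (s1 b r).
Local Notation argopt := (argopt k b r).
Local Notation optinv := (optinv k b r).
Local Notation Bval := (Bval k b r).
Local Notation tau := (tau k b r).
Local Notation istate := (istate k b r).
Local Notation iter_cost := (iter_cost k b r).

Lemma rate_le i j : (i <= j <= k)%N -> r j <= r i.
Proof.
case/andP; elim: j => [|j IH]; first by rewrite leqn0 => /eqP->.
rewrite leq_eqVlt => /predU1P[->//|ij] jk.
by apply: le_trans (IH ij (ltnW jk)); exact/ltW/r_decr.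
Qed.

Lemma rate_ge0 i : (i <= k)%N -> 0 <= r i.
Proof. by move=> ik; apply: (le_trans rk_ge0); apply: rate_le; rewrite ik leqnn. Qed.

Lemma rate0_gt0 : 0 < r 0%N.
Proof. by apply: (@le_lt_trans _ _ (r 1%N)); [exact: rate_ge0|exact: r_decr]. Qed.

Lemma cost_ge i : (i <= k)%N -> b 0%N <= b i.
Proof.
elim: i => // i IH ik; apply: le_trans (IH (ltnW ik)) _.
exact/ltW/b_incr.
Qed.

Lemma cost_ge0 i : (i <= k)%N -> 0 <= b i.
Proof. by move=> /cost_ge; exact: le_trans b0_ge0. Qed.

Lemma opt_le i t : (i <= k)%N -> opt t <= b i + r i * t.
Proof.
move=> ik; have ik' : (i < k.+1)%N by [].
exact: (bigmin_le _ (Ordinal ik') (fun i : 'I_k.+1 => b i + r i * t)).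
Qed.

Lemma opt_attained t : exists2 i, (i <= k)%N & opt t = b i + r i * t.
Proof.
apply: (big_ind (fun v => exists2 i, (i <= k)%N & v = b i + r i * t)).
- by exists 0%N.
- move=> u v [i ik ->] [j jk ->].
  by rewrite minEle; case: ifP => _; [exists i|exists j].
- by move=> i _; exists i => //; rewrite -ltnS.
Qed.

Lemma opt_mono s t : s <= t -> opt s <= opt t.
Proof.
move=> st; have [i ik ->] := opt_attained t.
by apply: le_trans (opt_le s ik) _; rewrite lerD2l ler_wpM2l ?rate_ge0.
Qed.

(** No line is steeper than [r 0]. This is the quantitative continuity that ties [optinv] to [opt]
    below. *)
Lemma opt_lipschitz s t : s <= t -> opt t <= opt s + r 0%N * (t - s).
Proof.
move=> st; have [i ik ->] := opt_attained s; apply: le_trans (opt_le t ik) _.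
have : r i * (t - s) <= r 0%N * (t - s).
  by rewrite ler_wpM2r ?subr_ge0// rate_le ?ik.
lra.
Qed.

Lemma opt0 : opt 0 = b 0%N.
Proof.
have := opt_le 0 (leq0n k); rewrite mulr0 addr0 => h.
apply/eqP; rewrite eq_le h /=.
by have [i ik ->] := opt_attained 0; rewrite mulr0 addr0 cost_ge.
Qed.

Lemma opt_ge t : 0 <= t -> b 0%N <= opt t.
Proof. by move=> t0; rewrite -opt0 opt_mono. Qed.

Lemma s1_gt0 : 0 < s1.
Proof. by rewrite divr_gt0// subr_gt0 ?b_incr ?r_decr. Qed.

(* At its useful time [t1], slope 1 is below every slope [i > 1]; these are
   flatter, so they stay above it before [t1], while slope 1 is above slope 0
   before [s1 <= t1]. *)
Lemma opt_before_s1 t : t <= s1 -> opt t = b 0%N + r 0%N * t.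
Proof.
move=> ts; apply/eqP; rewrite eq_le opt_le//=.
have r01 : 0 < r 0%N - r 1%N by rewrite subr_gt0 r_decr.
have line s : s <= s1 -> b 0%N + r 0%N * s <= b 1%N + r 1%N * s.
  by rewrite /Defs.s1 ler_pdivlMr// => ?; lra.
have [i ik ->] := opt_attained t; case: i ik => // i ik.
have [t1 [t10 E1]] := useful k_gt0.
have s1t1 : s1 <= t1.
  rewrite /Defs.s1 ler_pdivrMr//.
  by have := opt_le t1 (leq0n k); rewrite E1; lra.
have := opt_le t1 ik; rewrite E1 => h.
apply: le_trans (line t ts) _.
have : (r 1%N - r i.+1) * t <= (r 1%N - r i.+1) * t1.
  by rewrite ler_wpM2l ?(le_trans ts)// subr_ge0 rate_le.
lra.
Qed.

Lemma opt_s1_gt : b 0%N < opt s1.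
Proof. by rewrite opt_before_s1// ltrDl mulr_gt0 ?rate0_gt0 ?s1_gt0. Qed.

Lemma opt_s1_gt0 : 0 < opt s1.
Proof. exact: le_lt_trans b0_ge0 opt_s1_gt. Qed.

Lemma argoptP t :
  (argopt t <= k)%N /\ b (argopt t) + r (argopt t) * t = opt t.
Proof.
have h : has (fun i => b i + r i * t == opt t) (iota 0 k.+1).
  have [i ik E] := opt_attained t; apply/hasP; exists i.
    by rewrite mem_iota.
  by rewrite E.
have := h; rewrite has_find size_iota => fk; split => //.
by have := nth_find 0%N h; rewrite nth_iota// => /eqP.
Qed.

Lemma argopt_before_s1 t : t <= s1 -> argopt t = 0%N.
Proof. by move=> ts; rewrite /Defs.argopt /= opt_before_s1// eqxx. Qed.

Lemma istate_le x j : (istate x j <= k)%N.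
Proof.
case: j => [|j] //=; case: (optinv _) => [t| |] //.
by case: (argoptP t).
Qed.

Lemma optinv_ge0 B : (0 <= optinv B)%E.
Proof. by apply: le_ereal_inf_tmp => _ [t [t0 _] <-]; rewrite lee_fin. Qed.

Lemma optinv_mono B B' : B <= B' -> (optinv B <= optinv B')%E.
Proof.
move=> BB'; apply: ereal_inf_le_tmp => _ [t [t0 Bt] <-]; exists t => //.
by split => //; exact: le_trans Bt.
Qed.

Lemma optinv_le B t : 0 <= t -> B <= opt t -> (optinv B <= t%:E)%E.
Proof. by move=> t0 Bt; apply: ereal_inf_lbound; exists t. Qed.

(** The infimum in [optinv] is attained: if [opt t < B], then climbing at rate at most [r 0] the
    envelope cannot reach B before t + d. *)
Lemma le_opt_of_optinv_le B t : (optinv B <= t%:E)%E -> B <= opt t.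
Proof.
move=> Bt; rewrite leNgt; apply/negP => tB.
pose d := (B - opt t) / r 0%N.
have d0 : 0 < d by rewrite divr_gt0 ?subr_gt0 ?rate0_gt0.
have : (optinv B < (t + d)%:E)%E.
  by apply: le_lt_trans Bt _; rewrite lte_fin ltrDl.
move=> /ereal_inf_lt[_ [u [u0 Bu] <-]]; rewrite lte_fin => utd.
have [tu|ut] := leP t u; last first.
  by have := le_trans Bu (opt_mono (ltW ut)); rewrite leNgt tB.
have : r 0%N * (u - t) < r 0%N * d by rewrite ltr_pM2l ?rate0_gt0//; lra.
rewrite [r 0%N * d]mulrC divfK ?gt_eqF ?rate0_gt0//.
by have := opt_lipschitz tu; lra.
Qed.

(** The envelope does not jump over B: if [opt t > B], then B was already reached at t - d. When t <
    d, climbing from [opt 0 = b 0 <= B] leaves too little time to exceed B by that much. *)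
Lemma opt_optinv_le B t : b 0%N <= B -> optinv B = t%:E -> opt t <= B.
Proof.
move=> bB Et; have t0 : 0 <= t by rewrite -lee_fin -Et optinv_ge0.
rewrite leNgt; apply/negP => Bt.
pose d := (opt t - B) / r 0%N.
have d0 : 0 < d by rewrite divr_gt0 ?subr_gt0 ?rate0_gt0.
have Ed : r 0%N * d = opt t - B by rewrite mulrC divfK ?gt_eqF ?rate0_gt0.
have [dt|td] := leP d t.
  have : (optinv B <= (t - d)%:E)%E.
    apply: optinv_le; first by rewrite subr_ge0.
    have : t - d <= t by lra.
    by move=> /opt_lipschitz; rewrite opprB addrCA subrr addr0 Ed; lra.
  by rewrite Et lee_fin; lra.
have := opt_lipschitz t0; rewrite opt0 subr0.
have : r 0%N * t < r 0%N * d by rewrite ltr_pM2l ?rate0_gt0.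
by rewrite Ed; lra.
Qed.

Lemma opt_lt_of_optinv_pinfty B t : 0 <= t -> optinv B = +oo%E -> opt t < B.
Proof.
move=> t0 E; rewrite ltNge; apply/negP => /(optinv_le t0).
by rewrite E leye_eq.
Qed.

(** Line [k] is the flattest, so once optimal it stays optimal. This justifies choosing state [k]
    when [tau] is infinite. *)
Lemma opt_eventually : exists t0, forall t, t0 <= t -> b k + r k * t <= opt t.
Proof.
have [t0 [_ E]] := useful (leqnn k); exists t0 => t tt.
have [i ik ->] := opt_attained t.
have := opt_le t0 ik; rewrite E.
have : r k * (t - t0) <= r i * (t - t0).
  by rewrite ler_wpM2r ?subr_ge0// rate_le ?ik ?leqnn.
lra.
Qed.

(** * Costs of the individual iterations *)

Lemma Bval1 x : 0 <= x -> Bval x 1 <= opt s1.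
Proof.
move=> x0; rewrite /Defs.Bval /= expR0 mulr1 ler_pdivrMr ?expR_gt0//.
by rewrite ler_peMr ?(ltW opt_s1_gt0)// -expR0 ler_expR.
Qed.

(** Ensures [b 0 <= B_j] for j >= 2, as [opt_optinv_le] requires; B_1 itself may lie below [b 0]. *)
Lemma Bval2 x l : x < 1 -> opt s1 < Bval x l.+2.
Proof.
move=> x1; rewrite /Defs.Bval /= -expRN -mulrA -expRD.
rewrite ltr_pMr ?opt_s1_gt0// -[ltLHS]expR0 ltr_expR addrC subr_gt0.
by apply: lt_le_trans x1 _; rewrite ler1n.
Qed.

Lemma tau_ge0 x j : (0 <= tau x j)%E.
Proof. by case: j => [|j] //; exact: optinv_ge0. Qed.

Lemma tau_le x j : (tau x j <= tau x j.+1)%E.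
Proof.
case: j => [|j]; first exact: tau_ge0.
apply: optinv_mono; rewrite /Defs.Bval /=.
by rewrite ler_pM2l ?divr_gt0 ?opt_s1_gt0 ?expR_gt0// ler_expR ler_nat.
Qed.

Lemma iter_cost_ge0 x T j : (0 <= iter_cost x T j.+1)%E.
Proof.
rewrite /Defs.iter_cost -pred_Sn; case: ifPn => // h; rewrite lee_fin addr_ge0//.
  by case: ifP => // _; exact/cost_ge0/istate_le.
rewrite mulr_ge0 ?rate_ge0 ?istate_le// subr_ge0.
have := tau_ge0 x j; have := tau_le x j; move: h.
case: (tau x j) => [s| |]//; case: (tau x j.+1) => [t| |]//.
by rewrite -EFin_min !lee_fin /= le_min => -> ->.
Qed.

(* In iteration 1 the state is still 0, so nothing is bought. *)
Lemma first_iteration_cost x T : 0 <= x -> 0 <= T ->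
  ((b 0%N)%:E + iter_cost x T 1 <= (Num.min (opt T) (opt s1))%:E)%E.
Proof.
move=> x0 T0.
have := optinv_le (ltW s1_gt0) (Bval1 x0).
have := optinv_ge0 (Bval x 1).
rewrite /Defs.iter_cost /= lee_fin T0 /=.
case: (optinv (Bval x 1)) => [t| |]//; rewrite !lee_fin => t0 ts.
rewrite argopt_before_s1// eqxx add0r -EFin_min /= subr0.
(* Slope 0 is optimal up to [s1], so the cost equals [opt] at the minimum of t and T. *)
by rewrite -opt_before_s1 ?ge_min ?ts// le_min !opt_mono// ge_min ?ts ?lexx ?orbT.
Qed.

(** Charging rent from time 0 instead of from the start of the iteration turns the cost into the
    value of line i at the end, which is [opt (tau x l.+2)] when that time is finite. *)
Lemma later_iteration_cost x T l : 0 <= T -> 0 <= x < 1 ->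
  (iter_cost x T l.+2 <=
   (if Bval x l.+1 <= opt T then Bval x l.+2 else 0)%:E)%E.
Proof.
move=> T0 /andP[x0 x1]; have As := Bval2 l x1.
have bB : b 0%N <= Bval x l.+2 by rewrite (le_trans (ltW opt_s1_gt))// ltW.
have B0 : 0 <= Bval x l.+2 by exact: le_trans bB.
rewrite /Defs.iter_cost -pred_Sn; case: ifPn => [tT|_]; last first.
  by rewrite lee_fin; case: ifP.
rewrite (le_opt_of_optinv_le tT).
rewrite lee_fin; have ik := istate_le x l.+2.
set i := istate x l.+2 in ik *.
apply: (@le_trans _ _ (b i + r i * fine (Order.min (tau x l.+2) T%:E))).
  rewrite lerD//; first by case: ifP => // _; exact: cost_ge0.
  by rewrite ler_wpM2l ?rate_ge0// gerBl fine_ge0 ?tau_ge0.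
rewrite /i /=; case E : (optinv (Bval x l.+2)) => [t| |].
- have [ak Ea] := argoptP t; apply: le_trans (opt_optinv_le bB E).
  by rewrite -Ea -EFin_min /= lerD2l ler_wpM2l ?rate_ge0// ge_min lexx.
(* Infinite last iteration: extend the rent to a time where line [k] is optimal; [opt] still stays
   below [Bval x l.+2] there. *)
- rewrite min_r ?leey//=; have [t0 ht0] := opt_eventually.
  have m0 : 0 <= Num.max T t0 by rewrite le_max T0.
  apply: le_trans (ltW (opt_lt_of_optinv_pinfty m0 E)).
  apply: le_trans (ht0 _ _); last by rewrite le_max lexx orbT.
  by rewrite lerD2l ler_wpM2l// le_max lexx.
- by have := optinv_ge0 (Bval x l.+2); rewrite E.
Qed.

Lemma Bval_expRN x l : Bval x l.+1 = opt s1 * expR l%:R * expR (- x).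
Proof. by rewrite /Defs.Bval /= expRN mulrAC. Qed.

Lemma BvalS x l : Bval x l.+2 = expR 1 * Bval x l.+1.
Proof.
by rewrite !Bval_expRN -addn1 natrD expRD; ring.
Qed.

Lemma strat_cost_ge0 x T : (0 <= strat_cost k b r x T)%E.
Proof.
rewrite adde_ge0 ?lee_fin//; apply: nneseries_ge0 => n _ _.
exact: iter_cost_ge0.
Qed.

Lemma strat_cost_le x T : 0 <= T -> 0 <= x < 1 ->
  (strat_cost k b r x T <= (Num.min (opt T) (opt s1))%:E +
    \sum_(l <oo) (if (Bval x l.+1 <= opt T)%R then Bval x l.+2 else 0)%:E)%E.
Proof.
move=> T0 x01; have /andP[x0 x1] := x01.
rewrite /strat_cost nneseries_recl//; last by move=> n _; exact: iter_cost_ge0.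
rewrite addeA leeD ?first_iteration_cost//.
rewrite -(@nneseries_addn _ (fun j => iter_cost x T j.+1) 1%N); last first.
  by move=> n; exact: iter_cost_ge0.
apply: lee_nneseries => [n _ _|n _]; first exact: iter_cost_ge0.
by rewrite addn1; exact: later_iteration_cost.
Qed.

End LowerEnvelope.

(** * Expectation over the random shift x *)

Theorem theorem5p1 (R : realType) (k : nat) (b r : nat -> R)
  (hk : (0 < k)%N)
  (hb0 : 0 <= b 0%N)
  (hb : forall i, (i < k)%N -> b i < b i.+1)
  (hr : forall i, (i < k)%N -> r i.+1 < r i)
  (hrk : 0 <= r k)
  (huseful : forall i, (i <= k)%N ->
     exists t : R, 0 <= t /\ opt k b r t = b i + r i * t)
  (T : R) (hT : 0 <= T) :
  (expected_cost k b r T <= (expR 1 * opt k b r T)%:E)%E.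
Proof.
pose P := opt k b r T; pose A := opt k b r (s1 b r).
have A0 : 0 < A by exact: opt_s1_gt0.
have e0 : 0 < expR 1 :> R by exact: expR_gt0.
have P0 : 0 <= P by apply: (le_trans hb0); exact: opt_ge.
(* [C l] is B_(l+1) at x = 0, so [h l x] is B_(l+1) if it is at most P, and 0 otherwise. *)
pose C l : R := A * expR l%:R.
have C0 l : 0 < C l by rewrite mulr_gt0 ?expR_gt0.
pose h l (x : R) : R := if C l * expR (- x) <= P then C l * expR (- x) else 0.
have h0 l x : 0 <= h l x.
  by rewrite /h; case: ifP => // _; rewrite mulr_ge0 ?expR_ge0 ?ltW.
have mh l : measurable_fun (`[0, 1[%classic : set R) (EFin \o h l).
  by apply/measurable_EFinP; exact: measurable_truncated_expRN.
have mS : measurable_fun (`[0, 1[%classic : set R)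
    (fun x => \sum_(l <oo) (h l x)%:E)%E.
  apply: (@ge0_emeasurable_sum _ _ _ _ (fun l x => (h l x)%:E) xpredT) => //.
  by move=> l x _ _; rewrite lee_fin.
  by move=> l _; exact: mh.
have S0 (x : R) : (0 <= \sum_(l <oo) (h l x)%:E)%E.
  by apply: nneseries_ge0 => l _ _; rewrite lee_fin h0.
rewrite /expected_cost.
have le1 : (\int[lebesgue_measure]_(x in `[0%R, 1%R[%classic)
    strat_cost k b r x T <=
  \int[lebesgue_measure]_(x in `[0%R, 1%R[%classic)
    ((Num.min P A)%:E + (expR 1)%:E * \sum_(l <oo) (h l x)%:E))%E.
  apply: ge0_le_integral_nonmeasurable => x /=; rewrite in_itv /= => x01.
    exact: strat_cost_ge0.
  apply: le_trans; first exact: strat_cost_le hT x01.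
  rewrite leeD2l// -nneseriesZl; last by move=> l _; rewrite lee_fin.
  have E l : (if Bval k b r x l.+1 <= P then Bval k b r x l.+2 else 0) =
      expR 1 * h l x.
    by rewrite BvalS Bval_expRN /h /C /A; case: ifP; rewrite ?mulr0.
  apply: lee_nneseries => [l _ _|l _]; rewrite E lee_fin //.
  by rewrite mulr_ge0 ?h0 ?ltW.
apply: (le_trans le1).
have m0 : 0 <= Num.min P A by rewrite le_min P0 ltW.
rewrite ge0_integralD//; last 2 first.
- by move=> x _; rewrite mule_ge0// lee_fin ltW.
- exact: measurable_funeM.
rewrite integral_cst//= lebesgue_measure_itv /= lte_fin ltr01 sube0 mule1.
rewrite ge0_integralZl// integral_nneseries// => [|l x _]; last by rewrite lee_fin.
(* The resulting bound is min(P, A) + max(e P - A, 0): for P > A it equals e P, and for P <= A it is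
   either P or P + e P - A. *)
apply: (@le_trans _ _ ((Num.min P A)%:E +
    (expR 1)%:E * (Num.max (P - A / expR 1) 0)%:E)%E); last first.
  rewrite -EFinM -EFinD lee_fin maxr_pMr ?(ltW e0)// mulr0 mulrBr mulrCA.
  rewrite mulfV ?gt_eqF//.
  have eP : P <= expR 1 * P by rewrite ler_peMl// -[leLHS]expR0 ler_expR.
  rewrite -/P !maxEle !minEle mulr1.
  by do ![case: ifPn; rewrite -?ltNge => ?]; lra.
rewrite leeD2l// lee_pmul2l//.
(* The series of integrals is bounded through its partial sums, for which the telescoping bound is
   uniform in n. *)
apply: lime_le.
  apply: is_cvg_nneseries => l _ _.
  by apply: integral_ge0 => x _; rewrite lee_fin.
near=> n; rewrite big_mkord.
apply: le_trans (_ : (\sum_(l < n)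
    Num.max (Num.min P (C l) - C l / expR 1) 0)%:E <= _)%E.
  rewrite -sumEFin; apply: lee_sum => l _.
  exact: integral_truncated_expRN.
by rewrite lee_fin sum_truncated_geometric.
Unshelve. all: by end_near. Qed.
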